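(* Let $\mathbb{H}\subset\mathbb{O}$ be a quaternionic subalgebra of the real octonions, and let $\mathcal{A}$ be an $n\times n$ Hermitian matrix with entries in $\mathbb{H}$ which is not complex (its entries do not all lie in a single complex subalgebra of $\mathbb{O}$). Let $\ell\in\mathbb{O}$ be a unit octonion orthogonal (in $\mathbb{R}^8$) to all elements of $\mathbb{H}$, so that $\mathbb{O}=\mathbb{H}\oplus\ell\mathbb{H}$. Let $v_1,\dots,v_n\in\mathbb{H}^n$ be orthonormal eigenvectors of $\mathcal{A}$, with $\mathcal{A}v_m=\lambda_m v_m$, $\lambda_m\in\mathbb{R}$, and let $u_1,\dots,u_n\in\mathbb{H}^n$ be orthonormal eigenvectors of the entrywise conjugate matrix $\overline{\mathcal{A}}$, with $\overline{\mathcal{A}}u_m=\mu_m u_m$, $\mu_m\in\mathbb{R}$. Let $x\in\mathbb{O}^n$ and write uniquely $x=x_1+\ell x_2$ with $x_1,x_2\in\mathbb{H}^n$. Then $$x=\sum_{m=1}^n v_m(v_m^\dagger x_1)+\sum_{m=1}^n\big((\ell u_m)(\ell u_m)^\dagger\big)(\ell x_2)=\sum_{m=1}^n v_mv_m^\dagger x_1+\ell\sum_{m=1}^n u_mu_m^\dagger x_2 ,$$ and each of these $2n$ components lies in an eigenspace of $\mathcal{A}$: $$\mathcal{A}\,(v_mv_m^\dagger x_1)=\lambda_m\,v_mv_m^\dagger x_1,\qquad \mathcal{A}\big(\ell(u_mu_m^\dagger x_2)\big)=\mu_m\,\ell(u_mu_m^\dagger x_2)\qquad(m=1,\dots,n)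.$$
   Context: $\mathbb{O}$ is the 8-dimensional real division algebra of octonions, viewed as the Euclidean space $\mathbb{R}^8$; a quaternionic (respectively complex) subalgebra is a unital subalgebra isomorphic to Hamilton's quaternions (respectively to $\mathbb{C}$). Vectors are column vectors, $v^\dagger$ denotes the conjugate transpose, and matrix products are computed by the usual row-by-column rule. For $\ell\in\mathbb{O}$ and a vector $w$, $\ell w$ denotes the vector with components $\ell w_i$. Orthonormality of vectors in $\mathbb{H}^n$ means $v_m^\dagger v_k=\delta_{mk}$. Products such as $v_mv_m^\dagger x_1$ involve only elements of the associative algebra $\mathbb{H}$, so no parentheses are needed. *)

(* Defs.v *)
From HB Require Import structures.
From mathcomp Require Import all_boot all_order all_algebra reals complex.
Set Implicit Arguments.
Unset Strict Implicit.
Unset Printing Implicit Defensive.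
Import GRing.Theory Num.Theory.
Local Open Scope ring_scope.

(* The n-th Cayley-Dickson algebra over R is carried by the Euclidean space
   R^(2^n); its dimension is written additively so that elements of the next
   algebra are, by conversion, row blocks (a, b) of two elements. *)
Fixpoint cd_dim (n : nat) : nat :=
  if n is m.+1 then (cd_dim m + cd_dim m)%N else 1%N.

Notation cayley_dickson R n := 'rV[R]_(cd_dim n).
Notation quaternion R := (cayley_dickson R 2).
Notation octonion R := (cayley_dickson R 3).

Section CayleyDickson.
Variable R : realType.

Fixpoint cd_one (n : nat) : cayley_dickson R n :=
  match n with
  | 0 => const_mx 1
  | m.+1 => row_mx (cd_one m) 0
  end.

(* (a, b)^* = (a^*, - b) *)
Fixpoint cd_conj (n : nat) : cayley_dickson R n -> cayley_dickson R n :=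
  match n with
  | 0 => fun x => x
  | m.+1 => fun x =>
      row_mx (cd_conj (@lsubmx R 1 (cd_dim m) (cd_dim m) x))
             (- @rsubmx R 1 (cd_dim m) (cd_dim m) x)
  end.

(* (a, b) (c, d) = (a c - d^* b, d a + b c^* ) *)
Fixpoint cd_mul (n : nat) :
    cayley_dickson R n -> cayley_dickson R n -> cayley_dickson R n :=
  match n with
  | 0 => fun x y => x *m y
  | m.+1 => fun x y =>
      let a := @lsubmx R 1 (cd_dim m) (cd_dim m) x in
      let b := @rsubmx R 1 (cd_dim m) (cd_dim m) x in
      let c := @lsubmx R 1 (cd_dim m) (cd_dim m) y in
      let d := @rsubmx R 1 (cd_dim m) (cd_dim m) y in
      row_mx (cd_mul a c - cd_mul (cd_conj d) b)
             (cd_mul d a + cd_mul b (cd_conj c))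
  end.

End CayleyDickson.

Section Octonions.
Variable R : realType.

Definition oone : octonion R := cd_one R 3.
Definition oconj (x : octonion R) : octonion R := cd_conj x.
Definition omul (x y : octonion R) : octonion R := cd_mul x y.

Definition odot (x y : octonion R) : R := \sum_k x 0 k * y 0 k.
Definition onorm (x : octonion R) : R := Num.sqrt (odot x x).

(* A real subspace H of the octonions is a unital subalgebra isomorphic to the
   unital R-algebra (A, mul, one). *)
Definition unital_subalgebra_iso (A : lmodType R) (mul : A -> A -> A) (one : A)
    (H : {vspace octonion R}) : Prop :=
  exists f : {linear A -> octonion R},
    [/\ injective f,
        f one = oone,
        forall a b, f (mul a b) = omul (f a) (f b)
      & forall x, x \in H <-> exists a, x = f a].

Definition quaternionic_subalgebra (H : {vspace octonion R}) : Prop :=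
  @unital_subalgebra_iso (quaternion R) (@cd_mul R 2) (cd_one R 2) H.

(* Rcomplex R is R[i] regarded as an R-module. *)
Definition complex_subalgebra (C : {vspace octonion R}) : Prop :=
  @unital_subalgebra_iso (Rcomplex R) *%R 1 C.

(* The library's matrix product needs an associative ring of entries. *)
Definition omulmx (m n p : nat) (A : 'M[octonion R]_(m, n))
    (B : 'M[octonion R]_(n, p)) : 'M[octonion R]_(m, p) :=
  \matrix_(i, k) \sum_j omul (A i j) (B j k).

Definition oconjmx (m n : nat) (A : 'M[octonion R]_(m, n)) :
    'M[octonion R]_(m, n) := map_mx oconj A.

Definition oadjmx (m n : nat) (A : 'M[octonion R]_(m, n)) :
    'M[octonion R]_(n, m) := (oconjmx A)^T.

Definition oscale (l : octonion R) (n : nat) (w : 'cV[octonion R]_n) :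
    'cV[octonion R]_n := map_mx (omul l) w.

Definition rscale (a : R) (n : nat) (w : 'cV[octonion R]_n) :
    'cV[octonion R]_n := map_mx (fun z => a *: z) w.

Definition ohermitian (n : nat) (A : 'M[octonion R]_n) : Prop := oadjmx A = A.

Definition entries_in (H : {vspace octonion R}) (m n : nat)
    (A : 'M[octonion R]_(m, n)) : Prop := forall i j, A i j \in H.

Definition complex_mx (n : nat) (A : 'M[octonion R]_n) : Prop :=
  exists2 C : {vspace octonion R}, complex_subalgebra C & entries_in C A.

Definition orthonormal_family (n : nat) (v : 'I_n -> 'cV[octonion R]_n) : Prop :=
  forall m k, omulmx (oadjmx (v m)) (v k) =
    const_mx (if m == k then oone else 0).

End Octonions.

Declare Scope oct_scope.
Delimit Scope oct_scope with oct.
(* Left associative: A ** B ** C is (A ** B) ** C. *)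
Notation "A ** B" := (omulmx A B) (at level 40, left associativity) : oct_scope.
Notation "l *<| w" := (oscale l w) (at level 40, left associativity) : oct_scope.
Notation "a *:| w" := (rscale a w) (at level 40, left associativity) : oct_scope.
Notation "A ^dag" := (oadjmx A) (at level 8, format "A ^dag") : oct_scope.

(* Main.v *)
From HB Require Import structures.
Require Import Defs.
From mathcomp Require Import all_boot all_order all_algebra reals.
From mathcomp Require Import ring.
Set Implicit Arguments.
Unset Strict Implicit.
Unset Printing Implicit Defensive.
Import GRing.Theory Num.Theory.
Local Open Scope ring_scope.
Local Open Scope oct_scope.

(** In an alternative *-algebra, a unit vector l orthogonal to an associative
    subalgebra H satisfies a (l b) = l (a^* b), (l a) b = l (b a) and
    (l a) (l b) = - b a^* for a, b in H. Hence left multiplication by a matrix A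
    over H acts on l H^n as l (conj A), and (l u) (l u)^dag maps l w to
    l (u u^dag w): eigenvectors of conj A give eigenvectors of A in l H^n. The
    expansion of x1 and x2 is the completeness of an orthonormal family of n
    vectors in H^n: a left inverse of a square matrix over H is also a right
    inverse, H being finite-dimensional over the reals. *)

(** * Cayley-Dickson algebras *)

Section CayleyDicksonTheory.
Variable R : realType.
Implicit Types (n : nat) (k : R).

Local Notation "x ∘ y" := (cd_mul x y) (at level 40, left associativity).
Local Notation "x ^conj" := (cd_conj x) (at level 2, format "x ^conj").

(** A row block that keeps its Cayley-Dickson type, so that at successor levels [cd_conj] and
    [cd_mul] are computed by rewriting instead of unfolding. *)
Definition cd_pair n (a b : cayley_dickson R n) : cayley_dickson R n.+1 :=
  row_mx a b.

Variant cd_pair_spec n : cayley_dickson R n.+1 -> Type :=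
  CdPair a b : cd_pair_spec (cd_pair a b).

Lemma cd_pairP n (x : cayley_dickson R n.+1) : cd_pair_spec x.
Proof. by rewrite -[x](@hsubmxK R 1 (cd_dim n) (cd_dim n)); constructor. Qed.

Lemma cd_pairD n (a b c d : cayley_dickson R n) :
  cd_pair a b + cd_pair c d = cd_pair (a + c) (b + d).
Proof. exact: add_row_mx. Qed.

Lemma cd_pairZ n k (a b : cayley_dickson R n) :
  k *: cd_pair a b = cd_pair (k *: a) (k *: b).
Proof. exact: scale_row_mx. Qed.

Lemma cd_one_pair n : cd_one R n.+1 = cd_pair (cd_one R n) 0.
Proof. by []. Qed.

Lemma cd_conj_pair n (a b : cayley_dickson R n) :
  (cd_pair a b)^conj = cd_pair (a^conj) (- b).
Proof. by rewrite /= /cd_pair row_mxKl row_mxKr. Qed.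

Lemma cd_mul_pair n (a b c d : cayley_dickson R n) :
  cd_pair a b ∘ cd_pair c d
  = cd_pair (a ∘ c - d^conj ∘ b) (d ∘ a + b ∘ c^conj).
Proof. by rewrite /= /cd_pair !row_mxKl !row_mxKr. Qed.

Lemma cd_conjD n : {morph @cd_conj R n : x y / x + y}.
Proof.
elim: n => [|n IH] // x y.
case: (cd_pairP x) (cd_pairP y) => a b [c d].
by rewrite cd_pairD !cd_conj_pair cd_pairD IH opprD.
Qed.

Lemma cd_conjZ n k (x : cayley_dickson R n) : (k *: x)^conj = k *: x^conj.
Proof.
elim: n x => [|n IH] // x; case: (cd_pairP x) => a b.
by rewrite cd_pairZ !cd_conj_pair cd_pairZ IH scalerN.
Qed.

Lemma cd_conjN n (x : cayley_dickson R n) : (- x)^conj = - x^conj.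
Proof. by rewrite -scaleN1r cd_conjZ scaleN1r. Qed.

Lemma cd_conjK n : involutive (@cd_conj R n).
Proof.
elim: n => [|n IH] // x; case: (cd_pairP x) => a b.
by rewrite !cd_conj_pair IH opprK.
Qed.

(** One induction for both laws: the doubling formula swaps factors, so [d ∘ a] puts part of the
    left argument on the right. *)
Let cd_mulD n :
  (forall x y z : cayley_dickson R n, (x + y) ∘ z = x ∘ z + y ∘ z) /\
  (forall x y z : cayley_dickson R n, z ∘ (x + y) = z ∘ x + z ∘ y).
Proof.
elim: n => [|n [IHl IHr]].
  by split=> x y z /=; rewrite ?mulmxDl ?mulmxDr.
split=> x y z; case: (cd_pairP x) (cd_pairP y) (cd_pairP z) => a b [c d] [e f];
  rewrite !(cd_pairD, cd_mul_pair) ?(cd_conjD, IHl, IHr);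
  by congr cd_pair; apply/rowP=> i; rewrite !mxE; ring.
Qed.

Lemma cd_mulDl n (x y z : cayley_dickson R n) : (x + y) ∘ z = x ∘ z + y ∘ z.
Proof. exact: (cd_mulD n).1. Qed.

Lemma cd_mulDr n (x y z : cayley_dickson R n) : z ∘ (x + y) = z ∘ x + z ∘ y.
Proof. exact: (cd_mulD n).2. Qed.

Let cd_mulZ n k :
  (forall x y : cayley_dickson R n, (k *: x) ∘ y = k *: (x ∘ y)) /\
  (forall x y : cayley_dickson R n, x ∘ (k *: y) = k *: (x ∘ y)).
Proof.
elim: n => [|n [IHl IHr]].
  by split=> x y /=; rewrite -?scalemxAl -?scalemxAr.
split=> x y; case: (cd_pairP x) (cd_pairP y) => a b [c d];
  by rewrite !(cd_pairZ, cd_mul_pair) ?(cd_conjZ, IHl, IHr) scalerBr scalerDr.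
Qed.

Lemma cd_mulZl n k (x y : cayley_dickson R n) : (k *: x) ∘ y = k *: (x ∘ y).
Proof. exact: (cd_mulZ n k).1. Qed.

Lemma cd_mulZr n k (x y : cayley_dickson R n) : x ∘ (k *: y) = k *: (x ∘ y).
Proof. exact: (cd_mulZ n k).2. Qed.

Lemma cd_mulNl n (x y : cayley_dickson R n) : (- x) ∘ y = - (x ∘ y).
Proof. by rewrite -scaleN1r cd_mulZl scaleN1r. Qed.

Lemma cd_mulNr n (x y : cayley_dickson R n) : x ∘ (- y) = - (x ∘ y).
Proof. by rewrite -scaleN1r cd_mulZr scaleN1r. Qed.

Lemma cd_0mul n (x : cayley_dickson R n) : 0 ∘ x = 0.
Proof. by have := cd_mulZl 0 0 x; rewrite !scale0r. Qed.

Lemma cd_conjM n (x y : cayley_dickson R n) : (x ∘ y)^conj = y^conj ∘ x^conj.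
Proof.
elim: n x y => [|n IH] x y.
  by apply/rowP=> i; rewrite !ord1 /= !mxE !big_ord1 mulrC.
case: (cd_pairP x) (cd_pairP y) => a b [c d].
rewrite !(cd_mul_pair, cd_conj_pair) cd_conjD !cd_conjN !IH !cd_conjK.
rewrite !(cd_mulNl, cd_mulNr).
by congr cd_pair; apply/rowP=> i; rewrite !mxE; ring.
Qed.

Lemma cd_conj1 n : (cd_one R n)^conj = cd_one R n.
Proof. by elim: n => // n IH; rewrite cd_one_pair cd_conj_pair IH oppr0. Qed.

Lemma cd_mul1 n (x : cayley_dickson R n) : x ∘ cd_one R n = x.
Proof.
elim: n x => [|n IH] x.
  by apply/rowP=> i; rewrite !ord1 /= !mxE !big_ord1 !mxE mulr1.
case: (cd_pairP x) => a b.
have conj0 : (0 : cayley_dickson R n)^conj = 0.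
  by have := cd_conjZ 0 (0 : cayley_dickson R n); rewrite !scale0r.
by rewrite cd_one_pair cd_mul_pair cd_conj1 conj0 !IH !cd_0mul subr0 add0r.
Qed.

Lemma cd_1mul n (x : cayley_dickson R n) : cd_one R n ∘ x = x.
Proof. by rewrite -[LHS]cd_conjK cd_conjM cd_conj1 cd_mul1 cd_conjK. Qed.

(** * The Euclidean inner product, traces and norms *)

Definition cd_dot n (x y : cayley_dickson R n) : R := \sum_i x 0 i * y 0 i.

Lemma cd_dot_pair n (a b c d : cayley_dickson R n) :
  cd_dot (cd_pair a b) (cd_pair c d) = cd_dot a c + cd_dot b d.
Proof.
rewrite /cd_dot big_split_ord /=.
by congr (_ + _); apply: eq_bigr => i _; rewrite ?row_mxEl ?row_mxEr.
Qed.

Lemma cd_dotDl n (x y z : cayley_dickson R n) :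
  cd_dot (x + y) z = cd_dot x z + cd_dot y z.
Proof. by rewrite -big_split; apply: eq_bigr => i _; rewrite mxE mulrDl. Qed.

Lemma cd_dotC n (x y : cayley_dickson R n) : cd_dot x y = cd_dot y x.
Proof. by apply: eq_bigr => i _; rewrite mulrC. Qed.

Lemma cd_dotxx_eq0 n (x : cayley_dickson R n) : cd_dot x x = 0 -> x = 0.
Proof.
move=> /psumr_eq0P x0; apply/rowP=> i; apply/eqP; rewrite mxE -sqrf_eq0 expr2.
by rewrite x0 // => j _; rewrite -expr2 sqr_ge0.
Qed.

(** Proved jointly because [x ∘ x^conj], for the pair of [a] and [b], produces [b^conj ∘ b] next to
    [a ∘ a^conj]. *)
Let cd_mul_conj2 n (x : cayley_dickson R n) :
  x ∘ x^conj = cd_dot x x *: cd_one R n /\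
  x^conj ∘ x = cd_dot x x *: cd_one R n.
Proof.
elim: n x => [|n IH] x.
  by split; apply/rowP=> i; rewrite !ord1 /= !mxE /cd_dot !big_ord1 mulr1.
case: (cd_pairP x) => a b; have [[aa aa'] [bb bb']] := (IH a, IH b).
rewrite cd_conj_pair !cd_mul_pair cd_dot_pair cd_one_pair cd_pairZ !cd_conjN.
rewrite !(cd_mulNl, cd_mulNr) !cd_conjK aa aa' bb' scaler0 scalerDl opprK.
by rewrite addNr subrr.
Qed.

Lemma cd_mul_conj n (x : cayley_dickson R n) :
  x ∘ x^conj = cd_dot x x *: cd_one R n.
Proof. exact: (cd_mul_conj2 x).1. Qed.

Lemma cd_conj_mul n (x : cayley_dickson R n) :
  x^conj ∘ x = cd_dot x x *: cd_one R n.
Proof. exact: (cd_mul_conj2 x).2. Qed.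

(** Polarization of [cd_mul_conj]; it converts orthogonality into a commutation rule. *)
Lemma cd_polar n (x y : cayley_dickson R n) :
  x ∘ y^conj + y ∘ x^conj = (cd_dot x y *+ 2) *: cd_one R n.
Proof.
have -> : x ∘ y^conj + y ∘ x^conj
    = (x + y) ∘ (x + y)^conj - x ∘ x^conj - y ∘ y^conj.
  rewrite cd_conjD cd_mulDl !cd_mulDr.
  by apply/rowP=> i; rewrite !mxE; ring.
rewrite !cd_mul_conj -!scalerBl; congr (_ *: _).
rewrite cd_dotDl 2!(cd_dotC _ (x + y)) !cd_dotDl (cd_dotC y x); ring.
Qed.

Lemma cd_trace n (x : cayley_dickson R n) :
  x + x^conj = (cd_dot x (cd_one R n) *+ 2) *: cd_one R n.
Proof. by rewrite -cd_polar cd_conj1 cd_mul1 cd_1mul. Qed.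

(** Traces, like the norms below, are real multiples of the unit, hence central. *)
Lemma cd_mul_traceC n (x y : cayley_dickson R n) :
  (x + x^conj) ∘ y = y ∘ (x + x^conj).
Proof.
by rewrite cd_trace cd_mulZl cd_mulZr cd_1mul cd_mul1.
Qed.

Lemma cd_mul_normC n (x y : cayley_dickson R n) :
  (x^conj ∘ x) ∘ y = y ∘ (x^conj ∘ x).
Proof.
by rewrite cd_conj_mul cd_mulZl cd_mulZr cd_1mul cd_mul1.
Qed.

(** * What survives each doubling: commutativity, associativity, alternativity *)

Lemma cd_mulC_S n :
  (forall x : cayley_dickson R n, x^conj = x) ->
  commutative (@cd_mul R n) -> commutative (@cd_mul R n.+1).
Proof.
move=> conj_id mulC x y; case: (cd_pairP x) (cd_pairP y) => a b [c d].
rewrite !cd_mul_pair !conj_id (mulC c a) (mulC d b); congr cd_pair.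
by rewrite addrC.
Qed.

(** When factors commute and associate, both sides are sums of the same signed monomials, which the
    rewrites sort. Used twice: for the complex numbers, then for the quaternions. *)
Lemma cd_mulA_S n :
  commutative (@cd_mul R n) -> associative (@cd_mul R n) ->
  associative (@cd_mul R n.+1).
Proof.
move=> mulC mulA x y z.
case: (cd_pairP x) (cd_pairP y) (cd_pairP z) => a b [c d] [e g].
have mulCA (p q r : cayley_dickson R n) : p ∘ (q ∘ r) = q ∘ (p ∘ r).
  by rewrite !mulA (mulC p).
rewrite !cd_mul_pair !(cd_conjD, cd_conjN, cd_conjM, cd_conjK).
rewrite !(cd_mulDl, cd_mulDr, cd_mulNl, cd_mulNr) -!mulA.
rewrite (mulCA a (g^conj)) (mulC a d) (mulCA e) (mulC e b).
rewrite (mulCA (c^conj)) (mulC (c^conj) b) (mulC c a) (mulC (e^conj) a).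
rewrite (mulC (e^conj)) (mulCA b (d^conj)) (mulC b g) (mulCA (d^conj) g).
by congr cd_pair; apply/rowP=> i; rewrite !mxE; ring.
Qed.

(** The two expansions agree once the trace [a + a^conj] and the norm [b^conj ∘ b], both central,
    are moved through the products. *)
Lemma cd_mulKA n : associative (@cd_mul R n) ->
  forall x y : cayley_dickson R n.+1, x ∘ (x ∘ y) = (x ∘ x) ∘ y.
Proof.
move=> mulA x y; case: (cd_pairP x) (cd_pairP y) => a b [c d].
have aC := cd_mul_traceC a (d^conj ∘ b); have bC := cd_mul_normC b.
rewrite !cd_mul_pair !(cd_conjD, cd_conjN, cd_conjM, cd_conjK).
rewrite !(cd_mulDl, cd_mulDr, cd_mulNl, cd_mulNr) -!mulA in aC *.
have bb p : p ∘ (b^conj ∘ b) = b^conj ∘ (b ∘ p) by rewrite -bC mulA.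
have bb' : b ∘ (b^conj ∘ d) = b^conj ∘ (b ∘ d).
  by rewrite !mulA cd_mul_conj -cd_conj_mul.
have aC' : b ∘ (a ∘ c^conj) + b ∘ (a^conj ∘ c^conj)
         = b ∘ (c^conj ∘ a) + b ∘ (c^conj ∘ a^conj).
  by rewrite -!cd_mulDr -cd_mulDl cd_mul_traceC cd_mulDr.
rewrite bb' !bb aC' -aC.
by congr cd_pair; apply/rowP=> i; rewrite !mxE; ring.
Qed.

Lemma quaternion_mulA : associative (@cd_mul R 2).
Proof.
have mulC0 : commutative (@cd_mul R 0).
  by move=> x y; apply/rowP=> i; rewrite !ord1 !mxE !big_ord1 mulrC.
have mulA0 : associative (@cd_mul R 0) by move=> x y z; apply: mulmxA.
by apply: cd_mulA_S; [apply: cd_mulC_S | apply: cd_mulA_S].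
Qed.

End CayleyDicksonTheory.

(** * The orthogonal complement of an associative subalgebra *)

Section AlternativeAlgebra.
Variables (R : realType) (V : vectType R).
Variables (mul : V -> V -> V) (conj : V -> V) (one : V) (dot : V -> V -> R).

(** The interface to the octonions: two alternative laws stand in for associativity, and [alt_polar]
    links [dot] to the product. *)
Record alternative_star_algebra := AlternativeStarAlgebra {
  altDl : forall x y z, mul (x + y) z = mul x z + mul y z;
  altDr : forall x y z, mul z (x + y) = mul z x + mul z y;
  altZl : forall k x y, mul (k *: x) y = k *: mul x y;
  altZr : forall k x y, mul x (k *: y) = k *: mul x y;
  alt_1mul : forall x, mul one x = x;
  alt_mul1 : forall x, mul x one = x;
  alt_mulKA : forall x y, mul x (mul x y) = mul (mul x x) y;
  alt_mulAK : forall x y, mul (mul y x) x = mul y (mul x x);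
  alt_conjD : forall x y, conj (x + y) = conj x + conj y;
  alt_conjK : forall x, conj (conj x) = x;
  alt_conjM : forall x y, conj (mul x y) = mul (conj y) (conj x);
  alt_conj1 : conj one = one;
  alt_dotxx_eq0 : forall x, dot x x = 0 -> x = 0;
  alt_polar : forall x y,
    mul x (conj y) + mul y (conj x) = (dot x y *+ 2) *: one
}.

Hypothesis altV : alternative_star_algebra.

Local Notation "x ∘ y" := (mul x y) (at level 40, left associativity).
Local Notation "x ^conj" := (conj x) (at level 2, format "x ^conj").

Let mulDl := altDl altV.
Let mulDr := altDr altV.
Let mulZl := altZl altV.
Let mulZr := altZr altV.
Let mul1x := alt_1mul altV.
Let mulx1 := alt_mul1 altV.
Let conjD := alt_conjD altV.
Let conjK := alt_conjK altV.
Let conjM := alt_conjM altV.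
Let conj1 := alt_conj1 altV.

Let mulx0 x : x ∘ 0 = 0.
Proof. by have := mulZr 0 x 0; rewrite !scale0r. Qed.

Let mul0x x : 0 ∘ x = 0.
Proof. by have := mulZl 0 0 x; rewrite !scale0r. Qed.

Let mulxN x y : x ∘ (- y) = - (x ∘ y).
Proof. by rewrite -scaleN1r mulZr scaleN1r. Qed.

Let mulNx x y : (- x) ∘ y = - (x ∘ y).
Proof. by rewrite -scaleN1r mulZl scaleN1r. Qed.

Let conj0 : (0 : V)^conj = 0.
Proof. by apply: (addrI (0 : V)^conj); rewrite -conjD !addr0. Qed.

Let mulx_sumr (I : finType) (F : I -> V) x :
  x ∘ (\sum_i F i) = \sum_i x ∘ F i.
Proof. exact: (big_morph (mul x) (fun a b => mulDr a b x) (mulx0 x)). Qed.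

Let mulx_suml (I : finType) (F : I -> V) x :
  (\sum_i F i) ∘ x = \sum_i F i ∘ x.
Proof.
exact: (big_morph (fun y => y ∘ x) (fun a b => mulDl a b x) (mul0x x)).
Qed.

(** Linearization: the left alternative law at [x + y], minus the laws at [x] and at [y]. *)
Lemma alt_altl x y z : x ∘ (y ∘ z) + y ∘ (x ∘ z) = (x ∘ y + y ∘ x) ∘ z.
Proof.
have := alt_mulKA altV (x + y) z.
rewrite !(mulDl, mulDr) -!(alt_mulKA altV) !addrA.
by move/addIr; rewrite -!addrA => /addrI.
Qed.

Lemma alt_altr x y z : (z ∘ x) ∘ y + (z ∘ y) ∘ x = z ∘ (x ∘ y + y ∘ x).
Proof.
have := alt_mulAK altV (x + y) z.
rewrite !(mulDl, mulDr) -!(alt_mulAK altV) !addrA.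
by rewrite (addrAC _ (z ∘ y ∘ x)); move/addIr; rewrite -!addrA => /addrI.
Qed.

Lemma alt_trace x : x + x^conj = (dot x one *+ 2) *: one.
Proof. by rewrite -(alt_polar altV) conj1 mulx1 mul1x. Qed.

Lemma alt_norm x : x ∘ x^conj = dot x x *: one.
Proof.
have := alt_polar altV x x; rewrite -mulr2n -scalerMnl -!scaler_nat.
by apply: scalerI; rewrite pnatr_eq0.
Qed.

(** * Products with a unit vector orthogonal to an associative subalgebra *)

Section Complement.
Variable H : {vspace V}.
Hypothesis H1 : one \in H.
Hypothesis HM : forall a b, a \in H -> b \in H -> a ∘ b \in H.
Hypothesis HA : forall a b c, a \in H -> b \in H -> c \in H ->
  a ∘ (b ∘ c) = a ∘ b ∘ c.

(** Conjugation is a real multiple of [one] minus the identity, and [one] lies in [H]. *)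
Let Hconj a : a \in H -> a^conj \in H.
Proof.
move=> aH; have -> : a^conj = (dot a one *+ 2) *: one - a.
  by rewrite -alt_trace addrC addKr.
by rewrite memvB ?memvZ.
Qed.

Variable l : V.
Hypothesis ll1 : dot l l = 1.
Hypothesis lH : forall h, h \in H -> dot l h = 0.

Lemma conj_orth : l^conj = - l.
Proof.
apply/eqP; rewrite -addr_eq0 addrC alt_trace lH //.
by rewrite mul0rn scale0r.
Qed.

(** Being imaginary of norm one, [l] squares to [- one]; alternativity does the rest. *)
Lemma mulK_orth z : l ∘ (l ∘ z) = - z.
Proof.
rewrite (alt_mulKA altV) -[l ∘ l]opprK -mulxN -conj_orth alt_norm ll1.
by rewrite scale1r mulNx mul1x.
Qed.

Lemma mulKr_orth z : (z ∘ l) ∘ l = - z.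
Proof.
rewrite (alt_mulAK altV) -[l ∘ l]opprK -mulxN -conj_orth alt_norm ll1.
by rewrite scale1r mulxN mulx1.
Qed.

Lemma mulC_orth a : a \in H -> a ∘ l = l ∘ a^conj.
Proof.
move=> aH; apply/esym/eqP; rewrite -subr_eq0 -mulxN -conj_orth.
by rewrite (alt_polar altV) lH // mul0rn scale0r.
Qed.

(** After adding [l ∘ (a ∘ z)], both sides are the real trace of [a] times [l ∘ z]: on the left by
    [alt_altl] and [mulC_orth]. *)
Lemma mulCA_orth a z : a \in H -> a ∘ (l ∘ z) = l ∘ (a^conj ∘ z).
Proof.
move=> aH; apply: (addIr (l ∘ (a ∘ z))).
rewrite alt_altl mulC_orth // -mulDr -(mulDr _ _ l) -mulDl [_ + a]addrC.
by rewrite alt_trace mulZr mulx1 !mulZl mul1x mulZr.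
Qed.

(** Writing [l ∘ a] as [a^conj ∘ l], the mirror rule [swap] gives [(a^conj ∘ b^conj) ∘ l], that is
    [(b ∘ a)^conj ∘ l], and [l] moves back to the left. *)
Lemma mulA_orth a b : a \in H -> b \in H -> (l ∘ a) ∘ b = l ∘ (b ∘ a).
Proof.
move=> aH bH; have swap z y : y \in H -> (z ∘ l) ∘ y = (z ∘ y^conj) ∘ l.
  move=> yH; apply: (addIr (z ∘ y ∘ l)).
  rewrite alt_altr mulC_orth // -mulDr -(mulDl _ _ l) -mulDr [_ + y]addrC.
  by rewrite alt_trace mulZr mulx1 !mulZr mulx1 mulZl.
rewrite -{1}[a]conjK -mulC_orth ?Hconj // swap // -conjM mulC_orth ?conjK //.
by rewrite Hconj // HM.
Qed.

(** After adding [l ∘ ((l ∘ a) ∘ b)], both sides are minus the real trace of [a] times [b]. *)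
Lemma mulM_orth a b : a \in H -> b \in H -> (l ∘ a) ∘ (l ∘ b) = - (b ∘ a^conj).
Proof.
move=> aH bH; apply: (addIr (l ∘ ((l ∘ a) ∘ b))).
rewrite alt_altl (mulA_orth aH bH) !mulK_orth.
rewrite -{1}[a]conjK -(mulC_orth (Hconj aH)) mulKr_orth -opprD mulNx.
rewrite [_ + a]addrC alt_trace mulZl mul1x -opprD -mulDr.
by rewrite [_ + a]addrC alt_trace mulZr mulx1.
Qed.

Lemma conj_mul_orth a : a \in H -> (l ∘ a)^conj = - (l ∘ a).
Proof.
by move=> aH; rewrite conjM conj_orth mulxN mulC_orth ?Hconj // conjK.
Qed.

(** If [b] were nonzero, multiplying [l ∘ b] on the right by [b^conj] would put a nonzero multiple
    of [l] in [H], to which [l] is orthogonal. *)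
Lemma eq0_orth b : b \in H -> l ∘ b \in H -> b = 0.
Proof.
move=> bH lbH; rewrite -[b]conjK; have [->|nb] := eqVneq (b^conj) 0.
  exact: conj0.
have nz : dot b^conj b^conj != 0.
  by apply: contraNneq nb => /(alt_dotxx_eq0 altV)->.
have : dot b^conj b^conj *: l \in H.
  suff <- : (l ∘ b) ∘ b^conj = dot b^conj b^conj *: l by rewrite HM ?Hconj.
  by rewrite mulA_orth ?Hconj // -{2}[b]conjK alt_norm mulZr mulx1.
move/(memvZ (dot b^conj b^conj)^-1); rewrite scalerA mulVf // scale1r.
by move/lH/eqP; rewrite ll1 oner_eq0.
Qed.

Lemma orth_decomp_uniq a b c d : a \in H -> b \in H -> c \in H -> d \in H ->
  a + l ∘ b = c + l ∘ d -> a = c /\ b = d.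
Proof.
move=> aH bH cH dH E; have bd : b = d.
  apply/eqP; rewrite -subr_eq0; apply/eqP/eq0_orth; first exact: memvB.
  rewrite mulDr mulxN; have -> : l ∘ b - l ∘ d = c - a; last exact: memvB.
  by apply/eqP; rewrite subr_eq addrAC -E addrAC subrr add0r.
by split=> //; move: E; rewrite bd => /addIr.
Qed.

(** Left multiplication by [l] is injective on [H] and its image meets [H] trivially, so the
    dimensions of the two subspaces add up to that of [V]. *)
Lemma orth_decomp : \dim {:V} = (\dim H).*2 ->
  exists p q : V -> V,
    forall y, [/\ p y \in H, q y \in H & y = p y + l ∘ q y].
Proof.
move=> dimV.
have lin : linear (mul l) by move=> k x y; rewrite mulDr mulZr.
pose f : {linear V -> V} :=
  HB.pack (mul l) (GRing.isLinear.Build R V V *:%R (mul l) lin).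
have fE z : linfun f z = l ∘ z by rewrite lfunE.
have cap0 : (H :&: linfun f @: H = 0)%VS.
  apply/eqP; rewrite -subv0; apply/subvP=> z.
  rewrite memv_cap memv0 => /andP[zH /memv_imgP[b bH zE]].
  by rewrite zE fE (eq0_orth bH) ?mulx0 // -fE -zE.
have dimU : \dim (linfun f @: H) = \dim H.
  apply: limg_dim_eq; apply/eqP; rewrite -subv0; apply/subvP=> z.
  rewrite memv_cap memv0 memv_ker fE => /andP[zH /eqP lz0].
  by rewrite (eq0_orth zH) ?lz0 ?mem0v.
have sumV : (H + linfun f @: H = fullv)%VS.
  apply/eqP; rewrite eqEdim subvf (dimv_disjoint_sum cap0) dimU addnn.
  by rewrite dimV leqnn.
exists (daddv_pi H (linfun f @: H)).
(* Since [l ∘ (l ∘ b) = - b], minus left multiplication by [l] recovers [b] from [l ∘ b]. *)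
exists (fun y => - (l ∘ daddv_pi (linfun f @: H) H y)) => y; split.
- exact: memv_pi.
- have /memv_imgP[b bH ->] := memv_pi (linfun f @: H) H y.
  by rewrite fE mulK_orth opprK.
- by rewrite mulxN mulK_orth opprK daddv_pi_add // sumV memvf.
Qed.

(** * Matrices over [H] acting on columns *)

Local Notation "A *o B" := (\matrix_(i, k) \sum_j A i j ∘ B j k)
  (at level 40, left associativity).

(** With the product above, [in_H] and [star] specialise by conversion to [omulmx], [entries_in] and
    [oadjmx]. *)
Let in_H m n (A : 'M[V]_(m, n)) := forall i j, A i j \in H.
Let star m n (A : 'M[V]_(m, n)) := (map_mx conj A)^T.

Let in_H_mul m n p (A : 'M[V]_(m, n)) (B : 'M[V]_(n, p)) :
  in_H A -> in_H B -> in_H (A *o B).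
Proof.
by move=> hA hB i j; rewrite mxE memv_suml // => k _; apply: HM.
Qed.

Let in_H_star m n (A : 'M[V]_(m, n)) : in_H A -> in_H (star A).
Proof. by move=> hA i j; rewrite !mxE Hconj. Qed.

Lemma mulmxA_in m n p q
    (A : 'M[V]_(m, n)) (B : 'M[V]_(n, p)) (C : 'M[V]_(p, q)) :
  in_H A -> in_H B -> in_H C -> A *o (B *o C) = A *o B *o C.
Proof.
move=> hA hB hC; apply/matrixP=> i j; rewrite !mxE.
under eq_bigr do rewrite mxE mulx_sumr.
under [RHS]eq_bigr do rewrite mxE mulx_suml.
rewrite exchange_big; apply: eq_bigr => k _; apply: eq_bigr => h _.
exact: HA.
Qed.

Lemma mulmx_orth m n p (A : 'M[V]_(m, n)) (B : 'M[V]_(n, p)) :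
  in_H A -> A *o map_mx (mul l) B = map_mx (mul l) (map_mx conj A *o B).
Proof.
move=> hA; apply/matrixP=> i j; rewrite !mxE mulx_sumr.
by apply: eq_bigr => k _; rewrite !mxE mulCA_orth.
Qed.

(** The outer product has entries [u_k ∘ u_i^conj], in reversed order; moving them past [l]
    conjugates them to [u_i ∘ u_k^conj]. *)
Lemma mulmx_orth_outer n p (u : 'cV[V]_n) (B : 'M[V]_(n, p)) : in_H u ->
  map_mx (mul l) u *o star (map_mx (mul l) u) *o map_mx (mul l) B
  = map_mx (mul l) (u *o star u *o B).
Proof.
move=> hu; apply/matrixP=> i j; rewrite !mxE mulx_sumr.
apply: eq_bigr => k _; rewrite !mxE !big_ord1 !mxE.
rewrite conj_mul_orth // mulxN mulM_orth // opprK mulCA_orth ?HM ?Hconj //.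
by rewrite conjM conjK.
Qed.

(* Left multiplication by A is an injective endomorphism of the
   finite-dimensional real space H^n, hence surjective. *)
Lemma mulmx_invC n (A B : 'M[V]_n) (x : 'cV[V]_n) :
  in_H A -> in_H B -> in_H x ->
  B *o A = \matrix_(i, j) (if i == j then one else 0) ->
  A *o (B *o x) = x.
Proof.
move=> hA hB hx BA.
have K (y : 'cV[V]_n) : in_H y -> B *o (A *o y) = y.
  move=> hy; rewrite mulmxA_in // BA; apply/matrixP=> i j; rewrite mxE.
  rewrite (bigD1 i) //= mxE eqxx mul1x big1 ?addr0 // => k /negPf ki.
  by rewrite mxE eq_sym ki mul0x.
(* [W] models H^n as a finite-dimensional space, so that kernels and inverses of linear maps apply;
   [vsproj] loses nothing, as [A] preserves H^n. *)
pose W := {ffun 'I_n -> subvs_of H}.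
pose col_of (c : W) : 'cV[V]_n := \col_i vsval (c i).
have col_in c : in_H (col_of c) by move=> i j; rewrite mxE subvsP.
pose T (c : W) : W := [ffun i => vsproj H ((A *o col_of c) i 0)].
have linT : linear T.
  move=> k c d; apply/ffunP=> i; rewrite !ffunE -linearP; congr (vsproj H _).
  rewrite !mxE scaler_sumr -big_split; apply: eq_bigr => j _ /=.
  by rewrite !mxE !ffunE linearP mulDr mulZr.
pose f : {linear W -> W} :=
  HB.pack T (GRing.isLinear.Build R W W *:%R T linT).
have colT c : col_of (T c) = A *o col_of c.
  apply/matrixP=> i j; rewrite ord1 [LHS]mxE ffunE vsprojK //.
  exact: in_H_mul.
have ker0 : lker (linfun f) == 0%VS.
  apply/lker0P => c d; rewrite !lfunE => /(congr1 col_of); rewrite !colT.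
  move/(congr1 (fun y : 'cV[V]_n => B *o y)); rewrite !K // => cd.
  by apply/ffunP=> i; apply: val_inj; move/matrixP/(_ i 0): cd; rewrite !mxE.
have [c ->] : exists c, x = A *o col_of c.
  exists ((linfun f)^-1%VF [ffun i => vsproj H (x i 0)]).
  rewrite -colT -[T _]/(f _) -[f _]lfunE lker0_lfunVK //.
  by apply/matrixP=> i j; rewrite ord1 mxE ffunE vsprojK.
by rewrite K.
Qed.

(** For [A] with columns [v m], orthonormality says that [star A] is a left inverse; [mulmx_invC]
    makes it a right inverse, which is completeness. *)
Lemma orthonormal_expansion n (v : 'I_n -> 'cV[V]_n) (x : 'cV[V]_n) :
  (forall m, in_H (v m)) -> in_H x ->
  (forall m k, star (v m) *o v k = const_mx (if m == k then one else 0)) ->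
  \sum_m v m *o (star (v m) *o x) = x.
Proof.
move=> hv hx vv; pose A : 'M[V]_n := \matrix_(i, m) v m i 0.
have hA : in_H A by move=> i j; rewrite mxE; apply: hv.
rewrite -[RHS](mulmx_invC hA (in_H_star hA) hx).
  apply/matrixP=> i j; rewrite summxE mxE; apply: eq_bigr => m _.
  rewrite !mxE big_ord1 !mxE; congr (_ ∘ _).
  by apply: eq_bigr => k _; rewrite !mxE.
apply/matrixP=> i j; move/matrixP/(_ 0 0): (vv i j); rewrite !mxE => <-.
by apply: eq_bigr => k _; rewrite !mxE.
Qed.

Let mulmxZl m n p k (A : 'M[V]_(m, n)) (B : 'M[V]_(n, p)) :
  map_mx (fun z => k *: z) A *o B = map_mx (fun z => k *: z) (A *o B).
Proof.
apply/matrixP=> i j; rewrite !mxE scaler_sumr.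
by apply: eq_bigr => h _; rewrite mxE mulZl.
Qed.

Lemma orth_eigen_decomp n (A : 'M[V]_n) (v u : 'I_n -> 'cV[V]_n)
    (lambda mu : 'I_n -> R) (x : 'cV[V]_n) :
  \dim {:V} = (\dim H).*2 -> in_H A ->
  (forall m, in_H (v m)) ->
  (forall m k, star (v m) *o v k = const_mx (if m == k then one else 0)) ->
  (forall m, A *o v m = map_mx (fun z => lambda m *: z) (v m)) ->
  (forall m, in_H (u m)) ->
  (forall m k, star (u m) *o u k = const_mx (if m == k then one else 0)) ->
  (forall m, map_mx conj A *o u m = map_mx (fun z => mu m *: z) (u m)) ->
  [/\ forall y : V, exists! h : V * V,
        [/\ h.1 \in H, h.2 \in H & y = h.1 + l ∘ h.2],
      exists! w : 'cV[V]_n * 'cV[V]_n,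
        [/\ in_H w.1, in_H w.2 & x = w.1 + map_mx (mul l) w.2]
    & forall x1 x2 : 'cV[V]_n,
        in_H x1 -> in_H x2 -> x = x1 + map_mx (mul l) x2 ->
        [/\ x = \sum_(m < n) v m *o (star (v m) *o x1)
                + \sum_(m < n) (map_mx (mul l) (u m) *o
                    star (map_mx (mul l) (u m))) *o map_mx (mul l) x2,
            \sum_(m < n) v m *o (star (v m) *o x1)
            + \sum_(m < n) (map_mx (mul l) (u m) *o
                star (map_mx (mul l) (u m))) *o map_mx (mul l) x2
            = \sum_(m < n) v m *o star (v m) *o x1
              + map_mx (mul l) (\sum_(m < n) u m *o star (u m) *o x2),
            forall m, A *o (v m *o star (v m) *o x1)
              = map_mx (fun z => lambda m *: z) (v m *o star (v m) *o x1)
          & forall m, A *o map_mx (mul l) (u m *o star (u m) *o x2)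
              = map_mx (fun z => mu m *: z)
                  (map_mx (mul l) (u m *o star (u m) *o x2))]].
Proof.
move=> dimV hA hv vv vE hu uu uE.
have [p [q pq]] := orth_decomp dimV.
split.
- move=> y; exists (p y, q y); split; first exact: pq.
  case=> a b [/= aH bH yE]; have [pH qH yE'] := pq y.
  by have [-> ->] := orth_decomp_uniq pH qH aH bH (etrans (esym yE') yE).
- exists (map_mx p x, map_mx q x); split.
    split=> [i j|i j|]; rewrite ?mxE; try by case: (pq (x i j)).
    by apply/matrixP=> i j; rewrite !mxE; case: (pq (x i j)).
  case=> a b [/= aH bH xE]; have E i j : p (x i j) = a i j /\ q (x i j) = b i j.
    have [pH qH yE'] := pq (x i j).
    apply: (orth_decomp_uniq pH qH (aH i j) (bH i j)); rewrite -yE' xE.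
    by rewrite !mxE.
  by congr (_, _); apply/matrixP=> i j; rewrite mxE; case: (E i j).
move=> x1 x2 h1 h2 xE.
have mul_lD (B C : 'cV[V]_n) :
    map_mx (mul l) (B + C) = map_mx (mul l) B + map_mx (mul l) C.
  by apply/matrixP=> i j; rewrite !mxE mulDr.
have mul_l0 : map_mx (mul l) (0 : 'cV[V]_n) = 0.
  by apply/matrixP=> i j; rewrite !mxE mulx0.
have assoc (w y : 'cV[V]_n) : in_H w -> in_H y ->
    w *o (star w *o y) = w *o star w *o y.
  by move=> hw hy; rewrite (mulmxA_in hw (in_H_star hw) hy).
have exp2 : \sum_(m < n) (map_mx (mul l) (u m) *o
      star (map_mx (mul l) (u m))) *o map_mx (mul l) x2
    = map_mx (mul l) (\sum_(m < n) u m *o star (u m) *o x2).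
  rewrite (big_morph _ mul_lD mul_l0).
  by apply: eq_bigr => m _; apply: mulmx_orth_outer.
have assoc_sum (w : 'I_n -> 'cV[V]_n) (y : 'cV[V]_n) :
    (forall m, in_H (w m)) -> in_H y ->
    \sum_m w m *o (star (w m) *o y) = \sum_m w m *o star (w m) *o y.
  by move=> hw hy; apply: eq_bigr => m _; apply: assoc.
split=> [||m|m].
- by rewrite exp2 -(assoc_sum _ _ hu h2) !orthonormal_expansion.
- by rewrite exp2 (assoc_sum _ _ hv h1).
(* Everything lies in [H]: reassociate so that [A] meets [v m], then pull out the real
   eigenvalue. *)
- rewrite -(assoc _ _ (hv m) h1).
  rewrite (mulmxA_in hA (hv m) (in_H_mul (in_H_star (hv m)) h1)) vE.
  exact: mulmxZl.
have hA' : in_H (map_mx conj A) by move=> i j; rewrite mxE Hconj.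
(* Moving [A] past [l] conjugates it, so it meets its eigenvector [u m]. *)
rewrite mulmx_orth // -(assoc _ _ (hu m) h2).
rewrite (mulmxA_in hA' (hu m) (in_H_mul (in_H_star (hu m)) h2)) uE mulmxZl.
apply/matrixP=> i j; rewrite [LHS]mxE [X in l ∘ X]mxE [RHS]mxE.
by rewrite [X in _ = _ *: X]mxE mulZr.
Qed.

End Complement.
End AlternativeAlgebra.

(** * Octonions *)

Section Octonions.
Variable R : realType.

Lemma octonion_alternative :
  alternative_star_algebra (@omul R) (@oconj R) (@oone R) (@odot R).
Proof.
have mulKA := cd_mulKA (@quaternion_mulA R).
have conjK := @cd_conjK R 3; have conjM := @cd_conjM R 3.
apply: (AlternativeStarAlgebra (@cd_mulDl R 3) (@cd_mulDr R 3) (@cd_mulZl R 3)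
  (@cd_mulZr R 3) (@cd_1mul R 3) (@cd_mul1 R 3) mulKA _ (@cd_conjD R 3) conjK
  conjM (@cd_conj1 R 3) (@cd_dotxx_eq0 R 3) (@cd_polar R 3)).
(* The right alternative law is the conjugate of the left one. *)
move=> x y; apply: (can_inj conjK).
exact: etrans (etrans (conjM _ _) (congr1 (omul (oconj x)) (conjM _ _)))
  (etrans (mulKA _ _) (esym (etrans (conjM _ _)
    (congr1 (fun z => omul z (oconj y)) (conjM _ _))))).
Qed.

(** The algebraic laws are carried over from the quaternions by the isomorphism; its injectivity
    gives [H] dimension 4, half of 8. *)
Lemma quaternionic_subalgebra_closed (H : {vspace octonion R}) :
  quaternionic_subalgebra H ->
  [/\ oone R \in H,
      forall a b, a \in H -> b \in H -> omul a b \in H,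
      forall a b c, a \in H -> b \in H -> c \in H ->
        omul a (omul b c) = omul (omul a b) c
    & \dim {:octonion R} = (\dim H).*2].
Proof.
case=> f [f_inj f1 fM Hf]; split.
- by apply/Hf; exists (cd_one R 2); rewrite f1.
- by move=> _ _ /Hf[a ->] /Hf[b ->]; apply/Hf; exists (cd_mul a b); rewrite fM.
- move=> _ _ _ /Hf[a ->] /Hf[b ->] /Hf[c ->].
  by rewrite -!fM quaternion_mulA.
have -> : H = limg (linfun f).
  apply/vspaceP=> x; apply/idP/idP => [/Hf[a ->]|/memv_imgP[a _ ->]].
    by rewrite -lfunE memv_img ?memvf.
  by rewrite lfunE; apply/Hf; exists a.
rewrite limg_dim_eq; first by rewrite !dimvf !dim_matrix.
have /eqP-> : lker (linfun f) == 0%VS; last exact: capv0.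
by apply/lker0P=> a b; rewrite !lfunE => /f_inj.
Qed.

End Octonions.

Theorem mainTheorem4 (R : realType) (H : {vspace octonion R}) (n : nat)
    (A : 'M[octonion R]_n) (l : octonion R)
    (v u : 'I_n -> 'cV[octonion R]_n) (lambda mu : 'I_n -> R)
    (x : 'cV[octonion R]_n) :
  quaternionic_subalgebra H ->
  entries_in H A -> ohermitian A -> ~ complex_mx A ->
  onorm l = 1 -> (forall h, h \in H -> odot l h = 0) ->
  (forall m, entries_in H (v m)) -> orthonormal_family v ->
  (forall m, A ** v m = lambda m *:| v m) ->
  (forall m, entries_in H (u m)) -> orthonormal_family u ->
  (forall m, oconjmx A ** u m = mu m *:| u m) ->
  [/\ (* O is the direct sum of H and l H *)
      forall y : octonion R, exists! h : octonion R * octonion R,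
        [/\ h.1 \in H, h.2 \in H & y = h.1 + omul l h.2],
      exists! w : 'cV[octonion R]_n * 'cV[octonion R]_n,
        [/\ entries_in H w.1, entries_in H w.2 & x = w.1 + l *<| w.2]
    & forall x1 x2 : 'cV[octonion R]_n,
        entries_in H x1 -> entries_in H x2 -> x = x1 + l *<| x2 ->
        [/\ x = \sum_(m < n) v m ** ((v m)^dag ** x1)
                + \sum_(m < n) ((l *<| u m) ** (l *<| u m)^dag) ** (l *<| x2),
            \sum_(m < n) v m ** ((v m)^dag ** x1)
            + \sum_(m < n) ((l *<| u m) ** (l *<| u m)^dag) ** (l *<| x2)
            = \sum_(m < n) v m ** (v m)^dag ** x1
              + l *<| (\sum_(m < n) u m ** (u m)^dag ** x2),
            forall m, A ** (v m ** (v m)^dag ** x1)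
                      = lambda m *:| (v m ** (v m)^dag ** x1)
          & forall m, A ** (l *<| (u m ** (u m)^dag ** x2))
                      = mu m *:| (l *<| (u m ** (u m)^dag ** x2))]].
Proof.
move=> /quaternionic_subalgebra_closed[H1 HM HA dimO] hA _ _ l1 lH.
have ll1 : odot l l = 1.
  have := congr1 (fun r => r ^+ 2) l1; rewrite /= /onorm sqr_sqrtr ?expr1n //.
  by apply: sumr_ge0 => i _; rewrite -expr2 sqr_ge0.
exact: (orth_eigen_decomp (octonion_alternative R) H1 HM HA ll1 lH x dimO hA).
Qed.
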